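(* Let $(S,A,\to)$ be an image-finite labelled transition system and ${\cal O}\subseteq{\it HML}$. (1) If for every formula $D[\bigwedge_{i\in I}\varphi_i]\in{\cal O}$ (with $D[]$ a context) such that $I$ is infinite and $d(\bigwedge_{i\in I}\varphi_i)=\infty$, we have $D[\bigwedge_{i\in J}\varphi_i]\in{\cal O}$ for all finite $J\subseteq I$, then the relations $\sim_{\cal O}$ and $\sim_{{\cal O}_{\rm FDP}}$ on $S$ coincide. (2) If for every formula $D[\bigwedge_{i\in I}\varphi_i]\in{\cal O}$ (with $D[]$ a context) such that $I$ is infinite, we have $D[\bigwedge_{i\in J}\varphi_i]\in{\cal O}$ for all finite $J\subseteq I$, then the relations $\sim_{\cal O}$ and $\sim_{{\cal O}_{\rm FIN}}$ on $S$ coincide.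
   Context: A labelled transition system consists of a set $S$ of states, a set $A$ of actions and transitions $s\xrightarrow{a}s'$; it is image-finite if for each $s$ and $a$ there are only finitely many transitions $s\xrightarrow{a}s'$. Hennessy-Milner logic ${\it HML}$ has formulas $\varphi ::= {\sf T} \mid \bigwedge_{i\in I}\varphi_i \mid \langle a\rangle\varphi \mid \neg\varphi$ ($a\in A$, $I$ arbitrary index set), with $s\models{\sf T}$; $s\models\bigwedge_{i\in I}\varphi_i$ iff $s\models\varphi_i$ for all $i$; $s\models\langle a\rangle\varphi$ iff some $s'$ with $s\xrightarrow{a}s'$ satisfies $\varphi$; $s\models\neg\varphi$ iff $s\not\models\varphi$. A context $D[]$ is a formula with exactly one occurrence of a hole $[]$ in place of a subformula; $D[\psi]$ replaces the hole by $\psi$. The depth $d:{\it HML}\to\mathbb{N}\cup\{\infty\}$ is defined by $d({\sf T})=0$, $d(\bigwedge_{i\in I}\varphi_i)=\sup\{d(\varphi_i)\mid i\in I\}$, $d(\langle a\rangle\varphi)=1+d(\varphi)$, $d(\neg\varphi)=d(\varphi)$. For ${\cal O}\subseteq{\it HML}$, $s\sim_{\cal O}s'$ means that $s$ and $s'$ satisfy exactly the same formulas of ${\cal O}$; ${\cal O}_{\rm FDP}=\{\varphi\in{\cal O}\mid d(\varphi)<\infty\}$, and ${\cal O}_{\rm FIN}$ is the set of formulas of ${\cal O}$ in which every conjunction $\bigwedge_{i\in I}$ (at any nesting level) has finite index set $I$. *)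

(* Defs.v *)
From mathcomp Require Import all_boot.
From mathcomp Require Import boolp classical_sets cardinality.

Set Implicit Arguments.
Unset Strict Implicit.
Unset Printing Implicit Defensive.

Local Open Scope classical_set_scope.

(* The extended natural numbers; [None] is infinity. *)
Definition enat := option nat.
Definition infty : enat := None.

Definition le_enat (x y : enat) : bool :=
  match x, y with
  | _, None => true
  | None, Some _ => false
  | Some m, Some n => m <= n
  end.

Definition succ_enat (x : enat) : enat := omap succn x.

(* The least natural upper bound if there is one, and infinity otherwise; in
   particular the supremum of the empty family is 0. *)
Definition sup_enat (I : Type) (x : I -> enat) : enat :=
  if pselect (exists n, (fun n => `[< forall i, le_enat (x i) (Some n) >]) n)
    is left bounded then Some (ex_minn bounded) else infty.

Lemma sup_enat_ub (I : Type) (x : I -> enat) i : le_enat (x i) (sup_enat x).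
Proof.
rewrite /sup_enat; case: pselect => [h|_]; last by case: (x i).
by case: ex_minnP => n /asboolP /(_ i).
Qed.

Lemma sup_enat_least (I : Type) (x : I -> enat) y :
  (forall i, le_enat (x i) y) -> le_enat (sup_enat x) y.
Proof.
move=> xy; rewrite /sup_enat; case: pselect => [h|nh].
  case: y xy => [m|] // xm.
  by case: ex_minnP => n _; apply; apply/asboolP.
case: y xy => [m|] // xm.
by case: nh; exists m; apply/asboolP.
Qed.

(* Index sets range over one fixed universe, shared by the conjunctions of
   formulas and contexts and by every later quantification over index sets. *)
Definition indexset := Type.

Inductive hml (A : Type) : Type :=
| Top
| Conj (I : indexset) (phi : I -> hml A)
| Dia (a : A) (phi : hml A)
| Neg (phi : hml A).

Arguments Top {A}.

Fixpoint sat (S A : Type) (trans : S -> A -> S -> Prop) (s : S) (phi : hml A)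
    : Prop :=
  match phi with
  | Top => True
  | Conj _ phi => forall i, sat trans s (phi i)
  | Dia a phi => exists2 s', trans s a s' & sat trans s' phi
  | Neg phi => ~ sat trans s phi
  end.

Fixpoint depth (A : Type) (phi : hml A) : enat :=
  match phi with
  | Top => Some 0
  | Conj _ phi => sup_enat (fun i => depth (phi i))
  | Dia a phi => succ_enat (depth phi)
  | Neg phi => depth phi
  end.

(* In [CConj], the hole lies in the conjunct of index [i0], and [phi] gives
   the other conjuncts, so that there is exactly one hole. *)
Inductive context (A : Type) : Type :=
| Hole
| CConj (I : indexset) (i0 : I) (D : context A)
    (phi : forall i : I, i <> i0 -> hml A)
| CDia (a : A) (D : context A)
| CNeg (D : context A).

Arguments Hole {A}.
Arguments CConj {A I} i0 D phi.

Fixpoint fill (A : Type) (D : context A) (psi : hml A) : hml A :=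
  match D with
  | Hole => psi
  | CConj _ i0 D phi =>
      Conj (fun i => match pselect (i = i0) with
                         | left _ => fill D psi
                         | right ne => phi i ne
                         end)
  | CDia a D => Dia a (fill D psi)
  | CNeg D => Neg (fill D psi)
  end.

Definition subconj (A : Type) (I : indexset) (phi : I -> hml A) (J : set I)
    : hml A :=
  Conj (fun i : {i : I | J i} => phi (proj1_sig i)).

Fixpoint finite_conjs (A : Type) (phi : hml A) : Prop :=
  match phi with
  | Top => True
  | Conj K phi => finite_set [set: K] /\ forall i, finite_conjs (phi i)
  | Dia a phi => finite_conjs phi
  | Neg phi => finite_conjs phi
  end.

Definition image_finite (S A : Type) (trans : S -> A -> S -> Prop) : Prop :=
  forall s a, finite_set [set s' | trans s a s'].

Definition logic_equiv (S A : Type) (trans : S -> A -> S -> Prop)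
    (O : set (hml A)) (s s' : S) : Prop :=
  forall phi, O phi -> (sat trans s phi <-> sat trans s' phi).

Definition fdp (A : Type) (O : set (hml A)) : set (hml A) :=
  [set phi | O phi /\ depth phi <> infty].

Definition fin (A : Type) (O : set (hml A)) : set (hml A) :=
  [set phi | O phi /\ finite_conjs phi].

(* Main.v *)
Require Import Defs.
From mathcomp Require Import all_boot.
From mathcomp Require Import boolp classical_sets cardinality.

Local Open Scope classical_set_scope.

(**
  Only finitely many states matter at a time. On a finite set [P] of states, an
  infinite conjunction agrees with a finite subconjunction, which picks one
  failing conjunct for each state of [P] that violates it; below a diamond, [P]
  is replaced by its finite set of successors. Hence every formula of [O] can be
  rewritten inside [O], from the outside to the inside, into one that agrees
  with it on [P] and whose remaining conjunctions are all harmless. For a given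
  pair of states, take [P] to be that pair.
*)

Lemma depth_conj_finite {A : Type} (I : indexset) (phi : I -> hml A) :
  finite_set [set: I] -> (forall i, depth (phi i) <> infty) ->
  depth (Conj phi) <> infty.
Proof.
move=> /(@finite_seqP {classic I})[r rE] phi_fin.
(* The maximum over the finitely many indices bounds the supremum. All depths are finite, so the
   default 0 of [odflt] never replaces an infinite one. *)
suff: le_enat (depth (Conj phi)) (Some (\max_(i <- r) odflt 0 (depth (phi i)))).
  by move=> le_max eq_infty; rewrite eq_infty in le_max.
apply: sup_enat_least => i; rewrite -/(depth (phi i)).
have ir : (i : {classic I}) \in r by have : [set: I] i by []; rewrite rE.
case phiE : (depth (phi i)) => [n|]; last by case: (phi_fin i).
have := @leq_bigmax_seq _ r xpredT (fun j => odflt 0 (depth (phi j))) i ir isT.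
by rewrite phiE.
Qed.

Lemma finite_set_sig {I : Type} (J : set I) :
  finite_set J -> finite_set [set: {i | J i}].
Proof.
move=> /(finite_preimage (f := @proj1_sig I J)).
have -> : @proj1_sig I J @^-1` J = setT by apply/seteqP; split=> // -[].
apply=> -[x Jx] [y Jy] _ _ /= xy; exact: eq_exist.
Qed.

Lemma finite_successors {S A : Type} (trans : S -> A -> S -> Prop) (a : A)
    (P : set S) :
  image_finite trans -> finite_set P ->
  finite_set [set s' | exists2 s, P s & trans s a s'].
Proof.
move=> trans_fin Pfin.
have := @bigcup_finite _ _ P (fun s => [set s' | trans s a s']) Pfin.
by apply=> s _; exact: trans_fin.
Qed.

(** Membership in [O] concerns whole formulas, so descending to a subformula means moving the hole
    of the surrounding context inward. *)
Fixpoint compose {A : Type} (D E : context A) : context A :=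
  match D with
  | Hole => E
  | CConj _ i0 D phi => CConj i0 (compose D E) phi
  | CDia a D => CDia a (compose D E)
  | CNeg D => CNeg (compose D E)
  end.

Lemma fill_compose {A : Type} (D E : context A) (psi : hml A) :
  fill (compose D E) psi = fill D (fill E psi).
Proof. by elim: D => //= [I i0 D -> //|a D ->|D ->]. Qed.

Lemma subconj_agree {S A : Type} (trans : S -> A -> S -> Prop) (P : set S)
    (I : indexset) (phi : I -> hml A) :
  finite_set P -> [set: I] !=set0 ->
  exists2 J : set I, finite_set J &
    forall s, P s -> (sat trans s (subconj phi J) <-> sat trans s (Conj phi)).
Proof.
move=> Pfin [i0 _].
(* The index [f s] is a failing conjunct if [s] violates the conjunction, and the arbitrary [i0]
   otherwise. *)
have /choice[f fP] s : exists i, sat trans s (phi i) -> sat trans s (Conj phi).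
  have [sphi|/existsNP[i nphi]] := EM (sat trans s (Conj phi)).
    by exists i0.
  by exists i.
exists (f @` P); first exact: finite_image.
move=> s Ps; split=> [sJ|sphi i]; last exact: sphi.
have Jfs : (f @` P) (f s) by exists s.
by apply: fP; exact: (sJ (exist _ _ Jfs)).
Qed.

(* The predicate [good] stands for finite depth in (1) and for finite
   conjunctions in (2). *)
Lemma good_approximation {S A : Type} (trans : S -> A -> S -> Prop)
    (O good : set (hml A)) (phi : hml A) :
  image_finite trans ->
  good Top ->
  (forall a psi, good psi -> good (Dia a psi)) ->
  (forall psi, good psi -> good (Neg psi)) ->
  (forall (I : indexset) (psi : I -> hml A),
    finite_set [set: I] -> (forall i, good (psi i)) -> good (Conj psi)) ->
  (forall (D : context A) (I : indexset) (psi : I -> hml A),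
    O (fill D (Conj psi)) -> infinite_set [set: I] -> ~ good (Conj psi) ->
    forall J : set I, finite_set J -> O (fill D (subconj psi J))) ->
  forall (D : context A) (P : set S), finite_set P -> O (fill D phi) ->
  exists psi, [/\ O (fill D psi), good psi &
    forall s, P s -> (sat trans s psi <-> sat trans s phi)].
Proof.
move=> trans_fin goodT goodD goodN goodC closed.
elim: phi => [|I phi IH|a phi IH|phi IH] D P Pfin Ophi.
- by exists Top.
(* Stated for any finite family, since it serves both [phi] itself and the finite subfamily chosen
   from an infinite one. *)
- have finite_case (K : indexset) (chi : K -> hml A) :
      finite_set [set: K] ->
      (forall k (D' : context A), O (fill D' (chi k)) ->
        exists psi, [/\ O (fill D' psi), good psi &
          forall s, P s -> (sat trans s psi <-> sat trans s (chi k))]) ->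
      O (fill D (Conj chi)) ->
      exists psi, [/\ O (fill D psi), good psi &
        forall s, P s -> (sat trans s psi <-> sat trans s (Conj chi))].
    move=> Kfin IHchi Ochi; have /(@finite_seqP {classic K})[r rE] := Kfin.
    pose approx k psi := good psi /\
      forall s, P s -> (sat trans s psi <-> sat trans s (chi k)).
    (* The conjuncts are replaced one at a time, staying in [O] throughout. The last clause ensures
       that a conjunct not yet approximated is still the original [chi k], to which [IHchi]
       applies. *)
    suff [psi [Opsi psiP _]] : exists psi : K -> hml A,
        [/\ O (fill D (Conj psi)),
            forall k : {classic K}, k \in r -> approx k (psi k) &
            forall k : K, approx k (psi k) \/ psi k = chi k].
      have {}psiP k : approx k (psi k).
        by apply: psiP; have : [set: K] k by []; rewrite rE.
      exists (Conj psi); split=> //.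
        by apply: goodC => // k; case: (psiP k).
      move=> s Ps; split=> /= sat_all k.
        by case: (psiP k) => _ <-.
      by case: (psiP k) => _ ->.
    elim: r {rE} => [|k0 r [psi [Opsi psir psiP]]].
      by exists chi; split=> // k; right.
    have [k0psi|k0psi] := psiP k0.
      by exists psi; split=> // k; rewrite inE => /orP[/eqP ->|/psir].
    pose E psi0 := fun k : K => if pselect (k = k0) is left _ then psi0 else psi k.
    (* The hole sits at [k0], among the conjuncts as already modified; filling it with [chi k0]
       restores the current formula. *)
    pose D' := compose D (@CConj _ K k0 Hole (fun k _ => psi k)).
    have fillD' psi0 : fill D' psi0 = fill D (Conj (E psi0)).
      exact: fill_compose.
    have [|psi0 [Opsi0 good0 agree0]] := IHchi k0 D'.
      rewrite fillD'; suff -> : E (chi k0) = psi by [].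
      by apply/funext => k; rewrite /E; case: pselect => // ->.
    exists (E psi0); split=> [|k|k]; first by rewrite -fillD'.
    + rewrite inE /E; case: pselect => [-> //|kk0].
      by move=> /orP[/eqP/kk0|/psir].
    + by rewrite /E; case: pselect => [->|_]; [left|exact: psiP].
  have [Ifin|Iinf] := EM (finite_set [set: I]).
    by apply: finite_case => // i D'; exact: IH.
  (* A good infinite conjunction is kept whole. A bad one is first cut down to a finite [J], which
     [closed] permits, and only then are its conjuncts approximated. *)
  have [goodphi|badphi] := EM (good (Conj phi)).
    by exists (Conj phi).
  have [J Jfin JP] :=
    subconj_agree trans P I phi Pfin (infinite_setN0 Iinf).
  have [||psi [Opsi goodpsi psiP]] :=
    finite_case _ (fun i : {i | J i} => phi (proj1_sig i)) (finite_set_sig _ Jfin).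
  + by move=> [i Ji] D'; exact: IH.
  + exact: closed.
  + by exists psi; split=> // s Ps; rewrite psiP//; exact: JP.
- have [|psi [Opsi goodpsi psiP]] :=
      IH (compose D (CDia a Hole)) _ (finite_successors trans a P trans_fin Pfin).
    by rewrite fill_compose.
  exists (Dia a psi); split; [by rewrite fill_compose in Opsi|exact: goodD|].
  move=> s Ps; split=> -[s' ss' s'P]; exists s' => //; apply/psiP => //.
    by exists s.
  by exists s.
- have [|psi [Opsi goodpsi psiP]] := IH (compose D (CNeg Hole)) P Pfin.
    by rewrite fill_compose.
  exists (Neg psi); split; [by rewrite fill_compose in Opsi|exact: goodN|].
  by move=> s Ps /=; rewrite psiP.
Qed.

Lemma logic_equiv_good {S A : Type} (trans : S -> A -> S -> Prop)
    (O good : set (hml A)) :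
  image_finite trans ->
  good Top ->
  (forall a psi, good psi -> good (Dia a psi)) ->
  (forall psi, good psi -> good (Neg psi)) ->
  (forall (I : indexset) (psi : I -> hml A),
    finite_set [set: I] -> (forall i, good (psi i)) -> good (Conj psi)) ->
  (forall (D : context A) (I : indexset) (psi : I -> hml A),
    O (fill D (Conj psi)) -> infinite_set [set: I] -> ~ good (Conj psi) ->
    forall J : set I, finite_set J -> O (fill D (subconj psi J))) ->
  forall s s' : S,
    logic_equiv trans O s s' <-> logic_equiv trans (O `&` good) s s'.
Proof.
move=> trans_fin goodT goodD goodN goodC closed s s'; split.
  by move=> ss' phi [Ophi _]; exact: ss'.
move=> ss' phi Ophi.
have [psi [Opsi goodpsi psiP]] := good_approximation trans O good phi
    trans_fin goodT goodD goodN goodC closed Hole [set s; s'] (finite_set2 s s') Ophi.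
by rewrite -(psiP s (or_introl erefl)) -(psiP s' (or_intror erefl)); exact: ss'.
Qed.

Theorem theorem5 (S A : Type) (trans : S -> A -> S -> Prop)
    (trans_fin : image_finite trans) (O : set (hml A)) :
  ((forall (D : context A) (I : indexset) (phi : I -> hml A),
      O (fill D (Conj phi)) ->
      infinite_set [set: I] ->
      depth (Conj phi) = infty ->
      forall J : set I, finite_set J -> O (fill D (subconj phi J))) ->
   forall s s' : S,
     logic_equiv trans O s s' <-> logic_equiv trans (fdp O) s s') /\
  ((forall (D : context A) (I : indexset) (phi : I -> hml A),
      O (fill D (Conj phi)) ->
      infinite_set [set: I] ->
      forall J : set I, finite_set J -> O (fill D (subconj phi J))) ->
   forall s s' : S,
     logic_equiv trans O s s' <-> logic_equiv trans (fin O) s s').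
Proof.
split=> closed.
- apply: (logic_equiv_good trans O [set phi | depth phi <> infty]) => //.
  + by move=> a psi /=; case: (depth psi).
  + exact: @depth_conj_finite.
  (* Here failing to be good is a double negation of [depth (Conj psi) = infty]. *)
  + by move=> D I psi Opsi Iinf /contrapT; exact: closed.
- apply: (logic_equiv_good trans O (@finite_conjs A)) => //.
  by move=> D I psi Opsi Iinf _; exact: closed.
Qed.
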